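(* Let $\mathcal{P}$ be a radical parametrization, given together with a fixed representation as described in the context, and let $\mathcal{B}_\mathcal{P}\subset\mathbb{C}^{n+m+r}$ be its incidence variety and $\mathcal{A}_\mathcal{P}\subset\mathbb{C}^{n+m+r}$ its auxiliary variety. Then $\mathcal{B}_\mathcal{P}$ is contained in a unique irreducible component of $\mathcal{A}_\mathcal{P}$.
   Context: Let $\overline{t}=(t_1,\dots,t_n)$. A radical tower over $\mathbb{C}(\overline{t})$ is a tower of fields $\mathbb{F}_0=\mathbb{C}(\overline{t})\subseteq\mathbb{F}_1\subseteq\dots\subseteq\mathbb{F}_m$ with $\mathbb{F}_i=\mathbb{F}_{i-1}(\delta_i)$, where $\delta_i^{e_i}=\alpha_i\in\mathbb{F}_{i-1}$, $e_i\in\mathbb{N}$. A radical parametrization $\mathcal{P}$ is a tuple $\overline{x}=(x_1,\dots,x_r)$ of elements of $\mathbb{F}_m$, with $r>n$, whose Jacobian with respect to $\overline{t}$ (using the unique extensions of the derivations $\partial/\partial t_i$ to $\mathbb{F}_m$) has rank $n$; the $\delta_i$ are realized as analytic functions $\delta_i(\overline{t})$ by fixing values $\delta_i(\overline{t}_0)=a_i$ at some point $\overline{t}_0$ (choice of branches), so that $\overline{x}(\overline{t})$ is well defined. A representation of $\mathcal{P}$ consists of the tower together with polynomials such that $\alpha_1=\alpha_{1N}(\overline{t})/\alpha_{1D}(\overline{t})$, $\alpha_i=\alpha_{iN}(\overline{t},\delta_1,\dots,\delta_{i-1})/\alpha_{iD}(\overline{t},\delta_1,\dots,\delta_{i-1})$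 for $i=2,\dots,m$, and $x_j=x_{jN}(\overline{t},\overline{\delta})/x_{jD}(\overline{t},\overline{\delta})$ for $j=1,\dots,r$, where $\overline{\delta}=(\delta_1,\dots,\delta_m)$. Let $\varphi:\mathbb{C}^n\to\mathbb{C}^{n+m+r}$, $\overline{t}\mapsto(\overline{t},\overline{\delta}(\overline{t}),\overline{x}(\overline{t}))$ (defined where the expressions make sense). The incidence variety is $\mathcal{B}_\mathcal{P}=\overline{\mathrm{Im}(\varphi)}$ (Zariski closure). In $\mathbb{C}[\overline{T},\overline{\Delta},\overline{X},Z]$, with $\overline{T}=(T_1,\dots,T_n)$, $\overline{\Delta}=(\Delta_1,\dots,\Delta_m)$, $\overline{X}=(X_1,\dots,X_r)$, define $E_i=\Delta_i^{e_i}\alpha_{iD}(\overline{T},\Delta_1,\dots,\Delta_{i-1})-\alpha_{iN}(\overline{T},\Delta_1,\dots,\Delta_{i-1})$ ($i=1,\dots,m$), $G_j=X_jx_{jD}(\overline{T},\overline{\Delta})-x_{jN}(\overline{T},\overline{\Delta})$ ($j=1,\dots,r$), and $G_Z=Z\cdot\mathrm{lcm}(x_{1D},\dots,x_{rD},\alpha_{1D},\dots,\alpha_{mD})-1$. The auxiliary variety $\mathcal{A}_\mathcal{P}\subset\mathbb{C}^{n+m+r}$ is the Zariski closure of the projection of the common zero set $V(E_1,\dots,E_m,G_1,\dots,G_r,G_Z)\subset\mathbb{C}^{n+m+r+1}$ forgetting the last coordinate $Z$. *)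

(* Defs.v *)
From HB Require Import structures.
From mathcomp Require Import all_boot all_order all_algebra.
From mathcomp Require Import all_classical all_reals all_analysis.
From mathcomp Require Import complex.
From mathcomp Require mpoly.
Import (canonicals, coercions) mpoly.

Set Implicit Arguments.
Unset Strict Implicit.
Unset Printing Implicit Defensive.

Import Order.TTheory GRing.Theory Num.Theory.
Import numFieldNormedType.Exports.
Local Open Scope ring_scope.
Local Open Scope classical_set_scope.

(* Throughout, the complex numbers are C = R[i] for an arbitrary realType R
   (every realType is isomorphic to the real numbers).  Cplx R is R[i] seen as
   a numClosedFieldType, so that it gets its normed/topological structure
   (|z| = complex modulus) and 'rV[Cplx R]_n gets the usual topology of C^n. *)
Definition Cplx (R : realType) : numClosedFieldType := R[i].

Section AffineGeometry.
Variable R : realType.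
Local Notation C := (Cplx R).

Definition zero_set (N : nat) (S : set (mpoly.mpoly N C)) : set ('I_N -> C) :=
  [set v | forall p, S p -> mpoly.meval v p = 0].

Definition algebraic_set (N : nat) (A : set ('I_N -> C)) : Prop :=
  exists S : set (mpoly.mpoly N C), A = zero_set S.

Definition vanishing_ideal (N : nat) (A : set ('I_N -> C)) : set (mpoly.mpoly N C) :=
  [set p | forall v, A v -> mpoly.meval v p = 0].

Definition zariski_closure (N : nat) (A : set ('I_N -> C)) : set ('I_N -> C) :=
  zero_set (vanishing_ideal A).

Definition irreducible_set (N : nat) (A : set ('I_N -> C)) : Prop :=
  [/\ algebraic_set A, A <> set0 &
      forall B1 B2 : set ('I_N -> C), algebraic_set B1 -> algebraic_set B2 ->
        A = B1 `|` B2 -> A = B1 \/ A = B2].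

Definition irreducible_component (N : nat) (V W : set ('I_N -> C)) : Prop :=
  [/\ irreducible_set W, W `<=` V &
      forall W' : set ('I_N -> C), irreducible_set W' -> W `<=` W' -> W' `<=` V ->
        W' = W].

Definition mdvd (N : nat) (p q : mpoly.mpoly N C) : Prop :=
  exists s : mpoly.mpoly N C, q = p * s.

Definition is_lcm (N : nat) (P : set (mpoly.mpoly N C)) (L : mpoly.mpoly N C) : Prop :=
  (forall p, P p -> mdvd p L) /\
  (forall M, (forall p, P p -> mdvd p M) -> mdvd L M).

Definition only_vars (N : nat) (allowed : pred 'I_N) (p : mpoly.mpoly N C) : Prop :=
  forall (mono : mpoly.multinom N) (k : 'I_N),
    mpoly.mcoeff mono p != 0 -> ~~ allowed k -> mono k = 0%N.

End AffineGeometry.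

(** Radical parametrizations.
   Coordinates of C^(n+m) : T_1..T_n (indices 0..n-1), Delta_1..Delta_m
   (indices n..n+m-1).  Coordinates of C^(n+m+r) : T, Delta, then X_1..X_r.
   The representation polynomials alpha_iN, alpha_iD, x_jN, x_jD are
   polynomials in C[T, Delta] (alpha_i's only involving T, Delta_1..Delta_{i-1}). *)

Section RadicalParametrization.
Variable R : realType.
Local Notation C := (Cplx R).
Variables n m r : nat.

Definition td_point (t : 'rV[C]_n) (d : 'I_m -> C) : 'I_(n + m) -> C :=
  fun k => match fintype.split k with inl a => t ord0 a | inr i => d i end.

Definition td_of (delta : 'I_m -> 'rV[C]_n -> C) (t : 'rV[C]_n) : 'I_(n + m) -> C :=
  td_point t (fun i => delta i t).

Definition x_of (delta : 'I_m -> 'rV[C]_n -> C)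
    (xN xD : 'I_r -> mpoly.mpoly (n + m) C) (j : 'I_r) (t : 'rV[C]_n) : C :=
  mpoly.meval (td_of delta t) (xN j) / mpoly.meval (td_of delta t) (xD j).

Definition phi_map (delta : 'I_m -> 'rV[C]_n -> C)
    (xN xD : 'I_r -> mpoly.mpoly (n + m) C) (t : 'rV[C]_n) : 'I_(n + m + r) -> C :=
  fun k => match fintype.split k with
           | inl a => td_of delta t a
           | inr j => x_of delta xN xD j t end.

Definition phi_domain (U : set 'rV[C]_n) (delta : 'I_m -> 'rV[C]_n -> C)
    (aD : 'I_m -> mpoly.mpoly (n + m) C) (xD : 'I_r -> mpoly.mpoly (n + m) C) :
    set 'rV[C]_n :=
  [set t | [/\ U t,
              forall i, mpoly.meval (td_of delta t) (aD i) != 0 &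
              forall j, mpoly.meval (td_of delta t) (xD j) != 0]].

Definition incidence_variety (U : set 'rV[C]_n) (delta : 'I_m -> 'rV[C]_n -> C)
    (aD : 'I_m -> mpoly.mpoly (n + m) C) (xN xD : 'I_r -> mpoly.mpoly (n + m) C) :
    set ('I_(n + m + r) -> C) :=
  zariski_closure (phi_map delta xN xD @` phi_domain U delta aD xD).

Definition denominators (aD : 'I_m -> mpoly.mpoly (n + m) C)
    (xD : 'I_r -> mpoly.mpoly (n + m) C) : set (mpoly.mpoly (n + m) C) :=
  [set p | (exists j, p = xD j) \/ (exists i, p = aD i)].

(* projection (forgetting Z) of V(E_1..E_m, G_1..G_r, G_Z), where
   E_i = Delta_i^e_i alpha_iD - alpha_iN, G_j = X_j x_jD - x_jN,
   G_Z = Z * L - 1 with L the lcm of the denominators *)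
Definition aux_projection (e : 'I_m -> nat)
    (aN aD : 'I_m -> mpoly.mpoly (n + m) C) (xN xD : 'I_r -> mpoly.mpoly (n + m) C)
    (L : mpoly.mpoly (n + m) C) : set ('I_(n + m + r) -> C) :=
  [set p | exists z : C,
     let td := fun k : 'I_(n + m) => p (lshift r k) in
     [/\ forall i : 'I_m,
           p (lshift r (rshift n i)) ^+ e i * mpoly.meval td (aD i)
             - mpoly.meval td (aN i) = 0,
         forall j : 'I_r,
           p (rshift (n + m) j) * mpoly.meval td (xD j) - mpoly.meval td (xN j) = 0 &
         z * mpoly.meval td L - 1 = 0]].

Definition auxiliary_variety (e : 'I_m -> nat)
    (aN aD : 'I_m -> mpoly.mpoly (n + m) C) (xN xD : 'I_r -> mpoly.mpoly (n + m) C)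
    (L : mpoly.mpoly (n + m) C) : set ('I_(n + m + r) -> C) :=
  zariski_closure (aux_projection e aN aD xN xD L).

End RadicalParametrization.

(* Main.v *)
(** Call a family of points [x], each with [T]-coordinates, dichotomous when a
    product of two "good" functions without common zeros off a hypersurface
    [c(T) = 0] vanishes only if a factor does.  Two families are dichotomous:
    an irreducible closed set with polynomial functions, and [U] minus a
    hypersurface with continuous functions, because that set stays connected;
    no complex analysis is needed.  On a dichotomous family, adjoining radicals
    one after the other preserves the property that every function of the
    tower is identically zero or divides a nonzero polynomial in [T].
    - On [U] minus the zeros of the denominators, this makes the functions
      [P(t, delta(t), x(t))] an integral domain, so [B] is irreducible.
    - On an irreducible [W] with [B <= W <= A], a polynomial vanishing on [B]
      but not on [W] would divide a nonzero polynomial in [T] vanishing on [B];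
      such a polynomial vanishes on a nonempty open subset of C^n, hence is
      zero.  So [W = B].
    Hence [B] itself is the unique component of [A] containing [B]. *)

Require Import Defs.
From HB Require Import structures.
From mathcomp Require Import all_boot all_order all_algebra.
From mathcomp Require Import all_classical all_reals all_analysis.
From mathcomp Require Import complex.
From mathcomp Require mpoly.
From mathcomp Require Import ring lra.
Import (canonicals, coercions) mpoly.
Import Order.TTheory GRing.Theory Num.Theory.
Import numFieldNormedType.Exports.
Local Open Scope ring_scope.
Local Open Scope classical_set_scope.

(** * Algebra: adjoining radicals to rings of functions *)

Section Algebra.
Local Set Implicit Arguments.
Local Unset Strict Implicit.

(** Induction principle for evaluated polynomials, used for continuity, goodness and
    representability in a tower. Only coordinates occurring in [p] are tested, so that [only_vars]
    can supply the last premise. *)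
Lemma meval_closed (C : comNzRingType) (Pt : Type) (N : nat) (G : (Pt -> C) -> Prop)
    (w : Pt -> 'I_N -> C) (p : mpoly.mpoly N C) :
  (forall z, G (fun=> z)) ->
  (forall f g, G f -> G g -> G (fun x => f x + g x)) ->
  (forall f g, G f -> G g -> G (fun x => f x * g x)) ->
  (forall (mono : mpoly.multinom N) (k : 'I_N),
     mpoly.mcoeff mono p != 0 -> mono k != 0%N -> G (fun x => w x k)) ->
  G (fun x => mpoly.meval (w x) p).
Proof.
move=> Gc Ga Gm Gw.
have {}Gw mono : mono \in mpoly.msupp p -> forall k, G (fun x => w x k ^+ mono k).
  rewrite mpoly.mcoeff_msupp => p0 k; have [->|mk0] := eqVneq (mono k) 0%N.
    exact: (Gc 1).
  elim: (mono k) => [|j IHj]; first exact: (Gc 1).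
  under eq_fun do rewrite exprS.
  by apply: Gm => //; exact: Gw p0 mk0.
suff Gs (s : seq (mpoly.multinom N)) : {subset s <= mpoly.msupp p} ->
    G (fun x => \sum_(mono <- s) mpoly.mcoeff mono p * \prod_i w x i ^+ mono i).
  exact: (Gs _ (fun _ => id)).
elim: s => [|mono s IHs] sp; first by under eq_fun do rewrite big_nil.
under eq_fun do rewrite big_cons.
apply: (Ga (fun x => _) (fun x => _)); last by apply: IHs => x xs; apply: sp; rewrite inE xs orbT.
apply: (Gm (fun=> _) (fun x => _)); first exact: Gc.
have /Gw {}Gw : mono \in mpoly.msupp p by apply: sp; rewrite inE eqxx.
elim: (index_enum _) => [|k l IHl]; first by under eq_fun do rewrite big_nil.
under eq_fun do rewrite big_cons.
exact: (Gm (fun x => _) (fun x => _)).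
Qed.

(* [delta] is an [e.+1]-st root of [beta / gamma]; multiplication by
   [gamma * delta] acts on the row [1, delta, ..., delta ^+ e] through the
   companion-like matrix below, and [p] of it has [p.[delta]] as eigenvalue up
   to a power of [gamma]. *)
Definition radical_mx (A : comNzRingType) (e : nat) (gamma beta : A) : 'M[A]_e.+1 :=
  \matrix_(i, j) if j == ord_max then (if i == ord0 then beta else 0)
                 else if i == j.+1 :> nat then gamma else 0.

Definition radical_poly_mx (A : comNzRingType) (e : nat) (gamma beta : A) (p : {poly A}) :
  'M[A]_e.+1 :=
  \sum_(k < size p) (p`_k * gamma ^+ (size p - k)) *: radical_mx e gamma beta ^+ k.

Lemma mul_radical_mx (F : comNzRingType) (e : nat) (gamma beta delta : F) :
  delta ^+ e.+1 * gamma = beta ->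
  let v := \row_(j < e.+1) delta ^+ j in
  v *m radical_mx e gamma beta = (gamma * delta) *: v.
Proof.
move=> dE /=; apply/rowP => j; rewrite !mxE.
have [->|jm] := eqVneq j ord_max.
  (* In the last column the product would be [gamma * delta ^+ e.+1], which wraps around to
     [beta]. *)
  rewrite (bigD1 ord0) //= big1 => [|i i0]; rewrite !mxE eqxx ?(negPf i0) ?mulr0//.
  by rewrite expr0 mul1r addr0 -dE exprS mulrC mulrA.
have je : (j.+1 < e.+1)%N.
  by rewrite ltnS ltn_neqAle -ltnS ltn_ord andbT -(inj_eq val_inj) /= in jm *.
rewrite (bigD1 (Ordinal je)) //= big1 => [|i i0]; rewrite !mxE (negPf jm) /=.
  by rewrite eqxx addr0 exprS mulrC mulrA.
by rewrite ifN ?mulr0.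
Qed.

Lemma mul_radical_poly_mx (A F : comNzRingType) (h : {rmorphism A -> F}) (e : nat)
    (gamma beta : A) (p : {poly A}) (delta : F) :
  delta ^+ e.+1 * h gamma = h beta ->
  let v := \row_(j < e.+1) delta ^+ j in
  v *m map_mx h (radical_poly_mx e gamma beta p)
    = (h gamma ^+ size p * (map_poly h p).[delta]) *: v.
Proof.
move=> dE v.
have hN : map_mx h (radical_mx e gamma beta) = radical_mx e (h gamma) (h beta).
  by apply/matrixP => i j; rewrite !mxE; do ![case: ifP => //]; rewrite rmorph0.
have vN k : v *m radical_mx e (h gamma) (h beta) ^+ k = (h gamma * delta) ^+ k *: v.
  elim: k => [|k IHk]; first by rewrite !expr0 mulmx1 scale1r.
  by rewrite !exprS -mulmxE mulmxA mul_radical_mx // -scalemxAl IHk scalerA.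
rewrite /radical_poly_mx raddf_sum /= mulmx_sumr.
rewrite (@horner_coef_wide _ (size p)) ?size_poly // mulr_sumr scaler_suml.
apply: eq_bigr => k _; rewrite map_mxZ rmorphXn /= hN -scalemxAr vN scalerA coef_map /=.
rewrite rmorphM rmorphXn /= exprMn; congr (_ *: _).
have -> : h gamma ^+ size p = h gamma ^+ (size p - k) * h gamma ^+ k.
  by rewrite -exprD subnK // ltnW.
by rewrite [h p`_k * _]mulrC mulrACA.
Qed.

(** The eigenvalue [h gamma ^+ size p * g] is a root of the characteristic polynomial; moving the
    powers of [gamma] into the coefficients gives an equation for [g] itself. As [r] is chosen
    before [h] and [delta], one equation serves all points at once, and its top coefficient is
    nonzero wherever [gamma] is. *)
Lemma radical_relation (A : comNzRingType) (F : fieldType) (e : nat) (gamma beta : A)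
    (p : {poly A}) : exists r : {poly A},
  r`_e.+1 = gamma ^+ (size p * e.+1) /\
  forall (h : {rmorphism A -> F}) (delta : F), delta ^+ e.+1 * h gamma = h beta ->
    (map_poly h r).[(map_poly h p).[delta]] = 0.
Proof.
set chi := char_poly (radical_poly_mx e gamma beta p).
have chisz : size chi = e.+2 by rewrite size_char_poly.
exists (\poly_(k < e.+2) (chi`_k * gamma ^+ (size p * k))); split.
  rewrite coef_poly ltnSn -[e.+1]/(e.+2.-1) -{1}chisz -lead_coefE.
  by rewrite (monicP (char_poly_monic _)) mul1r.
move=> h delta dE; set g := (map_poly h p).[delta].
have vM := mul_radical_poly_mx p dE.
have : eigenvalue (map_mx h (radical_poly_mx e gamma beta p)) (h gamma ^+ size p * g).
  apply/eigenvalueP; eexists; first exact: vM.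
  (* The eigenvector is nonzero because its first entry is [delta ^+ 0]. *)
  apply/eqP => /rowP/(_ ord0); rewrite !mxE expr0 => /eqP.
  by rewrite oner_eq0.
rewrite eigenvalue_root_char -map_char_poly -/chi => /rootP.
rewrite (@horner_coef_wide _ e.+2); last first.
  by rewrite (leq_trans (size_poly _ _))// chisz.
rewrite (@horner_coef_wide _ e.+2); last first.
  by rewrite (leq_trans (size_poly _ _))// size_poly.
move=> chi0; rewrite -[RHS]chi0; apply: eq_bigr => k _; rewrite !coef_map /= coef_poly ltn_ord.
by rewrite rmorphM rmorphXn exprMn -exprM mulrA.
Qed.

(** Stands in for being algebraic over the field of fractions of [base]: a nonzero algebraic element
    of a domain divides a nonzero element of the base ring. Stated through values on [X], it makes
    sense although [A] need not be a domain. *)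
Definition divides_base (Pt : Type) (C : fieldType) (X : set Pt) (base : set (Pt -> C))
    (A : comNzRingType) (ev : Pt -> {rmorphism A -> C}) : Prop :=
  forall a, (forall x, X x -> ev x a = 0) \/
    exists b c, [/\ base c, exists2 x, X x & c x != 0 &
                    forall x, X x -> ev x a * ev x b = c x].

(** The positive and negative parts of a real function have product zero without either vanishing
    identically; the premise on common zeros excludes such pairs. *)
Definition dichotomy (Pt : Type) (C : fieldType) (X : set Pt) (good : set (Pt -> C))
    (c : Pt -> C) : Prop :=
  forall f g, good f -> good g -> (exists2 x, X x & c x != 0) ->
    (forall x, X x -> f x * g x = 0) ->
    (forall x, X x -> f x = 0 -> g x = 0 -> c x = 0) ->
    (forall x, X x -> f x = 0) \/ (forall x, X x -> g x = 0).

Section AdjoinRadical.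
Variables (Pt : Type) (C : fieldType) (X : set Pt) (base good : set (Pt -> C)).
Hypothesis good_add : forall f g, good f -> good g -> good (fun x => f x + g x).
Hypothesis good_mul : forall f g, good f -> good g -> good (fun x => f x * g x).
Hypothesis base_dichotomy : forall c, base c -> dichotomy X good c.

Definition eval_at (A : comNzRingType) (ev : Pt -> {rmorphism A -> C}) (delta : Pt -> C)
    (x : Pt) : {rmorphism {poly A} -> C} :=
  horner_morph (fun a => mulrC (delta x) (ev x a)).

Lemma eval_at_good (A : comNzRingType) (ev : Pt -> {rmorphism A -> C}) (delta : Pt -> C) :
  (forall a, good (fun x => ev x a)) -> good delta ->
  forall p, good (fun x => eval_at ev delta x p).
Proof.
move=> gev gd; elim/poly_ind => [|p a IHp].
  have -> : (fun x => eval_at ev delta x 0) = (fun x => ev x 0); last exact: gev.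
  by apply/funext => x; rewrite !rmorph0.
under eq_fun do rewrite rmorphD rmorphM /= horner_morphX horner_morphC.
by apply: good_add => //; apply: good_mul.
Qed.

(* With [b] the lowest coefficient, not identically zero, of an equation of
   [g = p.[delta]], one has [g * (b + g * s) = 0]; the dichotomy leaves
   [g = 0] or [- g * s = b], and [b] divides an element of [base]. *)
Lemma adjoin_radical (A : comNzRingType) (ev : Pt -> {rmorphism A -> C}) (delta : Pt -> C)
    (e : nat) (aN aD : A) :
  (forall a, good (fun x => ev x a)) -> good delta -> divides_base X base ev ->
  (0 < e)%N -> (exists2 x, X x & ev x aD != 0) ->
  (forall x, X x -> delta x ^+ e * ev x aD = ev x aN) ->
  divides_base X base (eval_at ev delta).
Proof.
move=> gev gd Hev e0 [x1 Xx1 aD1] dE p.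
have [/(_ _ Xx1)/eqP|[q [c [_ [x0 Xx0 c0] qE]]]] := Hev aD; first by rewrite (negPf aD1).
case: e e0 dE => // e _ dE.
have [r [re rE]] := radical_relation C e (aD * q) (aN * q) p.
pose nz j := `[< exists2 x, X x & ev x r`_j != 0 >].
have exj : exists j, nz j.
  exists e.+1; apply/asboolP; exists x0 => //.
  by rewrite re rmorphXn rmorphM qE // expf_neq0.
have [j /asboolP [x2 Xx2 rj2] jmin] := ex_minnP exj.
pose b := r`_j; pose s := drop_poly j.+1 r.
have [/(_ _ Xx2)/eqP|[b' [c' [basec' c'0 b'E]]]] := Hev b; first by rewrite (negPf rj2).
set g := fun x => eval_at ev delta x p.
have sE x : eval_at ev delta x (s \Po p) = (map_poly (ev x) s).[g x].
  by rewrite /= /horner_morph map_comp_poly horner_comp.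
have bgs x : eval_at ev delta x (b%:P + p * (s \Po p))
    = ev x b + g x * (map_poly (ev x) s).[g x].
  by rewrite rmorphD rmorphM sE /= horner_morphC.
(* The coefficients below [j] vanish on [X], so the equation reads [g ^+ j * (b + g * s) = 0]; a
   single factor [g] covers both [j = 0] and [j > 0]. *)
have relE x : X x -> g x * (ev x b + g x * (map_poly (ev x) s).[g x]) = 0.
  move=> Xx.
  have := rE (ev x) (delta x); rewrite !rmorphM !mulrA dE // => /(_ erefl).
  have -> : (map_poly (ev x) p).[delta x] = g x by [].
  rewrite -(poly_take_drop j r) rmorphD rmorphM /= map_polyXn hornerD hornerM hornerXn.
  have -> : map_poly (ev x) (take_poly j r) = 0.
    apply/polyP => k; rewrite coef_map /= coef_take_poly coef0; case: ifP => [kj|_];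
      last exact: rmorph0.
    apply/eqP/negPn/negP => rk; suff /jmin : nz k by rewrite leqNgt kj.
    by apply/asboolP; exists x.
  have -> : drop_poly j r = b%:P + s * 'X.
    apply/polyP => k; rewrite coefD coefC coefMX !coef_drop_poly.
    by case: k => [|k] /=; rewrite ?addr0 // add0r addSnnS.
  rewrite rmorphD rmorphM /= map_polyC map_polyX !hornerE => /eqP.
  rewrite mulf_eq0 expf_eq0 => /orP[|/andP[_]] /eqP => [|->]; last by rewrite mul0r.
  by rewrite [_ * g x]mulrC => ->; rewrite mulr0.
(* At a common zero of [g] and [b + g * s] one has [b = 0], hence [c' = b * b' = 0], as the
   dichotomy requires. *)
have := base_dichotomy basec' (eval_at_good gev gd p)
  (eval_at_good gev gd (b%:P + p * (s \Po p))) c'0.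
case=> [x Xx|x Xx||]; first by rewrite bgs relE.
- by rewrite bgs -/(g x) => -> ; rewrite mul0r addr0 => b0; rewrite -b'E // b0 mul0r.
- by left.
move=> gs; right; exists (- (s \Po p) * b'%:P), c'; split => // x Xx.
rewrite rmorphM rmorphN sE /= horner_morphC -b'E // mulrA mulrN; congr (_ * _).
by have := gs x Xx; rewrite bgs => /eqP; rewrite addr_eq0 => /eqP ->.
Qed.

End AdjoinRadical.

(** Induction on the number of adjoined coordinates: the ring of formal expressions starts as the
    polynomials in [T] and becomes [{poly A}] at each step. The map [u] places the variables of the
    defining polynomials among all coordinates, so the same statement serves with or without the
    coordinates [X]. *)
Lemma radical_tower (R : realType) (Pt : Type) (X : set Pt) (good : set (Pt -> Cplx R))
    (n N N' : nat) (tc : Pt -> 'I_n -> Cplx R) (w : Pt -> 'I_N -> Cplx R) (u : 'I_N' -> 'I_N) :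
  (forall z, good (fun=> z)) ->
  (forall f g, good f -> good g -> good (fun x => f x + g x)) ->
  (forall f g, good f -> good g -> good (fun x => f x * g x)) ->
  (forall k, good (fun x => w x k)) ->
  (forall a, exists k, forall x, tc x a = w x k) ->
  (forall c, dichotomy X good (fun x => mpoly.meval (tc x) c)) ->
  (forall k : 'I_N, (k < n)%N -> exists a, forall x, w x k = tc x a) ->
  (forall k : 'I_N, (n <= k)%N -> exists (e : nat) (aN aD : mpoly.mpoly N' (Cplx R)),
     [/\ (0 < e)%N, only_vars (fun j => (u j < k)%N) aN, only_vars (fun j => (u j < k)%N) aD,
       exists2 x, X x & mpoly.meval (fun j => w x (u j)) aD != 0 &
       forall x, X x -> w x k ^+ e * mpoly.meval (fun j => w x (u j)) aD
                        = mpoly.meval (fun j => w x (u j)) aN]) ->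
  forall P : mpoly.mpoly N (Cplx R),
    (forall x, X x -> mpoly.meval (w x) P = 0) \/
    exists q c, (exists2 x, X x & mpoly.meval (tc x) c != 0) /\
      forall x, X x -> mpoly.meval (w x) P * q x = mpoly.meval (tc x) c.
Proof.
move=> gc ga gm gw tcw dich wtc step.
pose base : set (Pt -> Cplx R) := [set f | exists c, f = fun x => mpoly.meval (tc x) c].
have basedich f : base f -> dichotomy X good f by case=> c ->; exact: dich.
pose repr (A : comNzRingType) (ev : Pt -> {rmorphism A -> Cplx R}) (f : Pt -> Cplx R) :=
  exists a, forall x, ev x a = f x.
have reprP (A : comNzRingType) (ev : Pt -> {rmorphism A -> Cplx R}) M
    (v : Pt -> 'I_M -> Cplx R) (p : mpoly.mpoly M (Cplx R)) :
    (forall z, repr A ev (fun=> z)) ->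
    (forall (mono : mpoly.multinom M) (k : 'I_M),
      mpoly.mcoeff mono p != 0 -> mono k != 0%N -> repr A ev (fun x => v x k)) ->
    repr A ev (fun x => mpoly.meval (v x) p).
  move=> rc; apply: meval_closed => // f g [a aE] [b bE]; [exists (a + b)|exists (a * b)] => x.
    by rewrite rmorphD aE bE.
  by rewrite rmorphM aE bE.
suff tower i : exists (A : comNzRingType) (ev : Pt -> {rmorphism A -> Cplx R}),
    [/\ forall a, good (fun x => ev x a), forall z, repr A ev (fun=> z),
        forall k : 'I_N, (k < n + i)%N -> repr A ev (fun x => w x k)
      & divides_base X base ev].
  move=> P; have [A [ev [_ rc rw dv]]] := tower N.
  have [mono k _ _|a aE] := reprP A ev _ w P rc.
    by apply: rw; rewrite (leq_trans (ltn_ord k)) ?leq_addl.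
  have [a0|[b [_ [[c ->] cX bE]]]] := dv a.
    by left=> x Xx; rewrite -aE a0.
  by right; exists (fun x => ev x b), c; split => // x Xx; rewrite -aE bE.
elim: i => [|i [A [ev [gev rc rw dv]]]].
  exists (mpoly.mpoly n (Cplx R)), (fun x => mpoly.meval (tc x)); split.
  - move=> c; apply: meval_closed => // mono a _ _; have [k ak] := tcw a.
    by under eq_fun do rewrite ak.
  - by move=> z; exists (mpoly.mpolyC n z) => x; exact: mpoly.mevalC.
  - move=> k; rewrite addn0 => /wtc[a wa]; exists (mpoly.mpolyX _ (mpoly.mnm1 a)) => x.
    by rewrite wa; exact: mpoly.mevalXU.
  - move=> c; have [c0|] := pselect (forall x, X x -> mpoly.meval (tc x) c = 0); first by left.
    move=> /existsNP[x /not_implyP[Xx /eqP cx]]; right; exists 1, (fun x => mpoly.meval (tc x) c).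
    by split; [exists c|exists x|move=> y Xy; rewrite rmorph1 mulr1].
have [niN|Nni] := ltnP (n + i) N; last first.
  exists A, ev; split => // k _; apply: rw.
  by rewrite (leq_trans (ltn_ord k)).
pose k0 := Ordinal niN.
have [e [aN [aD [e0 vN vD [x1 Xx1 aD1] dE]]]] := step k0 (leq_addr _ _).
have reprk0 p : only_vars (fun j => (u j < k0)%N) p ->
    repr A ev (fun x => mpoly.meval (fun j => w x (u j)) p).
  move=> vp; apply: (reprP A ev _ (fun x j => w x (u j))) => // mono j pj mj; apply: rw.
  by apply: contra_neqT mj; exact: vp.
have [aN' aN'E] := reprk0 _ vN; have [aD' aD'E] := reprk0 _ vD.
exists {poly A}, (eval_at ev (fun x => w x k0)); split.
- by apply: eval_at_good.
- move=> z; have [a aE] := rc z; exists a%:P => x.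
  by rewrite /= horner_morphC aE.
- move=> k; rewrite addnS ltnS leq_eqVlt => /predU1P[kE|/rw[a aE]].
    exists 'X => x; rewrite /= horner_morphX; congr (w x _).
    exact/val_inj.
  by exists a%:P => x; rewrite /= horner_morphC aE.
- apply: (adjoin_radical ga gm basedich (e := e) (aN := aN') (aD := aD')) => //.
    by exists x1; rewrite // aD'E.
  by move=> x Xx; rewrite aD'E aN'E dE.
Qed.

End Algebra.

(** * Topology: connectedness off a complex hypersurface *)

Section Topology.
Local Set Implicit Arguments.
Local Unset Strict Implicit.
Variable R : realType.
Local Notation C := (Cplx R).

Lemma below_positives (s : seq R) (b : R) : 0 < b ->
  exists2 a, 0 < a < b & forall y, y \in s -> 0 < y -> a < y.
Proof.
move=> b0; elim: s => [|z s [a /andP[a0 ab] aP]].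
  by exists (b / 2) => //; rewrite divr_gt0 //= ltr_pdivrMr // ltr_pMr // ltr1n.
have [z0|z0] := ltP 0 z; last first.
  exists a; first by rewrite a0.
  move=> y; rewrite inE => /predU1P[->|/aP//]; rewrite ltNge => /negP; by [].
exists (Num.min a (z / 2)).
  by rewrite lt_min a0 divr_gt0 //= gt_min ab.
move=> y; rewrite inE => /predU1P[-> _|ys y0]; rewrite gt_min; last by rewrite aP.
by rewrite [X in _ || X]ltr_pdivrMr // ltr_pMr // ltr1n orbT.
Qed.

Definition rC (x : R) : C := real_complex R x.

Definition line (n : nat) (s t : 'rV[C]_n) (z : C) : 'rV[C]_n := s + z *: (t - s).

(** On a complex line [c] restricts to a univariate polynomial, nonzero because of its value at
    [z0], which thus has finitely many roots. *)
Lemma roots_on_line (n : nat) (c : mpoly.mpoly n C) (s t : 'rV[C]_n) (z0 : C) :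
  mpoly.meval (fun a => line s t z0 ord0 a) c != 0 ->
  exists rs : seq C, forall z, mpoly.meval (fun a => line s t z ord0 a) c = 0 -> z \in rs.
Proof.
pose k : {poly C} := mpoly.mmap (@polyC C) (fun a => (s ord0 a)%:P + (t ord0 a - s ord0 a) *: 'X) c.
have kE z : mpoly.meval (fun a => line s t z ord0 a) c = k.[z].
  rewrite mpoly.mevalE /k /mpoly.mmap horner_sum; apply: eq_bigr => m _.
  rewrite hornerM hornerC; congr (_ * _); rewrite /mpoly.mmap1 horner_prod.
  by apply: eq_bigr => a _; rewrite horner_exp !hornerE !mxE mulrC.
move=> k0; have [rs rsE] := closed_field_poly_normal k.
exists rs => z; rewrite kE rsE hornerZ => /eqP; rewrite mulf_eq0 lead_coef_eq0.
have /negPf -> /= : k != 0 by apply: contraNneq k0 => k0; rewrite kE k0 horner0.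
by rewrite -rootE root_prod_XsubC.
Qed.

Lemma continuous_line (n : nat) (s t : 'rV[C]_n) : continuous (line s t).
Proof.
move=> z; have cs : {for z, continuous ((fun=> s) : C -> 'rV[C]_n)} by exact: cst_continuous.
have ct : {for z, continuous (fun z : C => z *: (t - s))} by exact: scalel_continuous.
exact: continuousD cs ct.
Qed.

Lemma continuous_meval (T : topologicalType) (N : nat) (w : T -> 'I_N -> C)
    (p : mpoly.mpoly N C) (x : T) :
  (forall k, {for x, continuous (fun y => w y k)}) ->
  {for x, continuous (fun y => mpoly.meval (w y) p)}.
Proof.
move=> wx; pose G (f : T -> C) : Prop := {for x, continuous f}.
have Gc z : G (fun=> z) by exact: cst_continuous.
have Ga f g : G f -> G g -> G (fun y => f y + g y) by move=> fx gx; exact: (continuousD fx gx).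
have Gm f g : G f -> G g -> G (fun y => f y * g y) by move=> fx gx; exact: (continuousM fx gx).
have Gw (mono : mpoly.multinom N) (k : 'I_N) :
  mpoly.mcoeff mono p != 0 -> mono k != 0%N -> G (fun y => w y k) by move=> _ _; exact: wx.
exact: (meval_closed Gc Ga Gm Gw).
Qed.

Lemma continuous_poly_row (n : nat) (p : mpoly.mpoly n C) :
  continuous (fun t : 'rV[C]_n => mpoly.meval (fun a => t ord0 a) p).
Proof. by move=> t; apply: continuous_meval => a; exact: coord_continuous. Qed.

Lemma continuous_neq0 (T : topologicalType) (f : T -> C) (x : T) :
  {for x, continuous f} -> f x != 0 -> \forall y \near x, f y != 0.
Proof.
move=> fx fx0; have := cvgr_neq0 _ fx fx0; exact.
Qed.

Lemma rC0 : rC 0 = 0. Proof. by []. Qed.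

Lemma rC1 : rC 1 = 1. Proof. by []. Qed.

Lemma rCD (x y : R) : rC (x + y) = rC x + rC y.
Proof. exact: (rmorphD (real_complex R)). Qed.

Lemma rCB (x y : R) : rC (x - y) = rC x - rC y.
Proof. exact: (rmorphB (real_complex R)). Qed.

Lemma rCM (x y : R) : rC (x * y) = rC x * rC y.
Proof. exact: (rmorphM (real_complex R)). Qed.

Lemma norm_rC (x : R) : `|rC x| = rC `|x|.
Proof. by rewrite /rC normc_def /= expr0n addr0 sqrtr_sqr. Qed.

Lemma ltrC (x y : R) : (rC x < rC y) = (x < y).
Proof. exact: ltcR. Qed.

Lemma gt0_rC (z : C) : 0 < z -> exists2 x : R, 0 < x & z = rC x.
Proof.
case: z => a b; rewrite ltcE /= => /andP[/eqP -> a0]; by exists a.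
Qed.

Lemma ge0_rC (z : C) : 0 <= z -> exists2 x : R, 0 <= x & z = rC x.
Proof.
case: z => a b; rewrite lecE /= => /andP[/eqP -> a0]; by exists a.
Qed.

Lemma continuous_rC : continuous rC.
Proof.
move=> x; apply/cvgrPdist_lt => e /gt0_rC[e' e'0 ->]; near=> y.
rewrite -rCB norm_rC ltrC; near: y.
exact: (@cvgr_dist_lt _ R^o).
Unshelve. all: by end_near. Qed.

Lemma connected_split (T : topologicalType) (A P Q : set T) :
  connected A -> open P -> open Q -> A `<=` P `|` Q -> A `&` P `&` Q = set0 ->
  A `<=` P \/ A `<=` Q.
Proof.
move=> cA oP oQ APQ PQ0.
have [[x [Ax Px]]|AP0] := pselect ((A `&` P) !=set0).
  left; have <- : A `&` P = A; last exact: subIsetr.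
  apply: cA; [by exists x|by exists P|exists (~` Q)]; first exact: open_closedC.
  apply/seteqP; split=> y [Ay]; last by case: (APQ y Ay).
  by move=> Py; split=> // Qy; rewrite -[False]/(set0 y) -PQ0.
right=> x Ax; case: (APQ x Ax) => // Px; exfalso; apply: AP0; by exists x.
Qed.

(** Inside the complex line through [s] and [t], the parameter runs from 0 to 1 along the arc
    [u + i * eta * u * (1 - u)]. Distinct [eta] give arcs meeting only at the endpoints, so a small
    generic [eta] misses the finitely many roots. *)
Lemma avoiding_path (n : nat) (c : mpoly.mpoly n C) (t0 s t : 'rV[C]_n) (rho : C) :
  ball t0 rho s -> ball t0 rho t ->
  mpoly.meval (fun a => s ord0 a) c != 0 -> mpoly.meval (fun a => t ord0 a) c != 0 ->
  exists gamma : R -> 'rV[C]_n, [/\ continuous gamma, gamma 0 = s, gamma 1 = t &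
    forall u, 0 <= u <= 1 ->
      ball t0 rho (gamma u) /\ mpoly.meval (fun a => gamma u ord0 a) c != 0].
Proof.
rewrite -!ball_normE /= => bs bt cs ct.
have line0 : line s t 0 = s by rewrite /line scale0r addr0.
have line1 : line s t 1 = t by rewrite /line scale1r addrC subrK.
have [rs rsP] := @roots_on_line n c s t 0 ltac:(by rewrite line0).
have [rho' _ rhoE] := gt0_rC (le_lt_trans (normr_ge0 _) bs).
have [ds _ dsE] := ge0_rC (normr_ge0 (t0 - s)).
have [dt _ dtE] := ge0_rC (normr_ge0 (t0 - t)).
have [d d0 dE] := ge0_rC (normr_ge0 (t - s)).
move: bs bt; rewrite dsE dtE rhoE !ltrC => bs bt.
have m0 : 0 < Num.min (rho' - ds) (rho' - dt) by rewrite lt_min !subr_gt0 bs.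
(* The quotient listed for a root is the only [eta] whose arc can meet it away from the endpoints.
   The upper bound keeps the arc in the ball; [d + 1] is positive even when [s = t]. *)
have [eta /andP[eta0 etab] etaP] := below_positives
  [seq complex.Im z / (complex.Re z * (1 - complex.Re z)) | z <- rs]
  (divr_gt0 m0 (ltr_wpDl d0 ltr01)).
pose z u : C := rC u + 'i%C * rC (eta * (u * (1 - u))).
have z0 : z 0 = 0 by rewrite /z mul0r mulr0 rC0 mulr0 addr0.
have z1 : z 1 = 1 by rewrite /z subrr !mulr0 addr0.
exists (fun u => line s t (z u)); split.
- move=> u; apply: (continuous_comp (f := z)); last exact: continuous_line.
  apply: continuousD; first exact: continuous_rC.
  apply: continuousM; first exact: cst_continuous.
  apply: (continuous_comp (g := rC)); last exact: continuous_rC.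
  apply: continuousM; first exact: cst_continuous.
  by apply: continuousM; [exact: cvg_id|apply: continuousB; [exact: cst_continuous|exact: cvg_id]].
- by rewrite z0 line0.
- by rewrite z1 line1.
have normi : `|'i%C : C| = 1.
  by rewrite normc_def /= expr0n expr1n add0r sqrtr1.
move=> u /andP[u0 u1]; split.
  have -> : line s t (z u) = t0 - (rC (1 - u) *: (t0 - s) + rC u *: (t0 - t)
      - ('i%C * rC (eta * (u * (1 - u)))) *: (t - s)).
    apply/rowP => a; rewrite /line /z !mxE rCB rC1.
    ring.
  rewrite subKr.
  apply: (le_lt_trans (ler_normB _ _)).
  apply: (le_lt_trans (lerD (ler_normD _ _) (lexx _))).
  rewrite !normrZ normrM normi mul1r !norm_rC dsE dtE dE -!rCM -!rCD ltrC.
  rewrite !ger0_norm ?mulr_ge0 ?subr_ge0 ?(ltW eta0) //.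
  move: etab; rewrite ltr_pdivlMr ?ltr_wpDl // lt_min => /andP[etas etat].
  have u1u : eta * (u * (1 - u)) * d <= eta * d.
    by rewrite ler_wpM2r // ler_piMr ?(ltW eta0) //; nra.
  have b1 : (1 - u) * ds <= (1 - u) * (rho' - eta * (d + 1)).
    by rewrite ler_wpM2l ?subr_ge0 // lerBrDl -lerBrDr ltW.
  have b2 : u * dt <= u * (rho' - eta * (d + 1)).
    by rewrite ler_wpM2l // lerBrDl -lerBrDr ltW.
  lra.
have [u00|uN0] := eqVneq u 0.
  by rewrite u00 z0 line0.
have [u11|uN1] := eqVneq u 1.
  by rewrite u11 z1 line1.
apply/eqP => /rsP zrs.
have zE : z u = Complex u (eta * (u * (1 - u))).
  by rewrite /z /rC; apply/eqP; rewrite eq_complex /=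
    !(mul0r, mulr0, mul1r, addr0, add0r, subr0) !eqxx.
have uu0 : u * (1 - u) != 0 by rewrite mulf_neq0 // subr_eq0 eq_sym.
suff : eta < eta by rewrite ltxx.
(* A root [z u] on the arc puts [eta] itself in the list of values that it lies below. *)
apply: etaP => //.
apply/mapP; exists (z u) => //.
by rewrite zE /= mulfK.
Qed.

(** On the line from [t] to [v], a small positive real parameter below the positive real parts of
    all roots avoids them. *)
Lemma nonzero_near (n : nat) (c : mpoly.mpoly n C) (t v : 'rV[C]_n) (V : set 'rV[C]_n) :
  mpoly.meval (fun a => v ord0 a) c != 0 -> nbhs t V ->
  exists2 t', V t' & mpoly.meval (fun a => t' ord0 a) c != 0.
Proof.
move=> cv Vt.
have line0 : line t v 0 = t by rewrite /line scale0r addr0.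
have [rs rsP] := @roots_on_line n c t v 1 ltac:(by rewrite /line scale1r addrC subrK).
have : nbhs (0 : C) (line t v @^-1` V) by apply: continuous_line; rewrite line0.
move=> /nbhs_ballP[e /= /gt0_rC[e' e'0 ->] eV].
have [a /andP[a0 ae] aP] := below_positives [seq complex.Re z | z <- rs] e'0.
exists (line t v (rC a)).
  by apply: eV; rewrite -ball_normE /= sub0r normrN norm_rC ltrC gtr0_norm.
apply/eqP => /rsP ars; suff : a < a by rewrite ltxx.
by apply: aP => //; apply/mapP; exists (rC a).
Qed.

(* Off the zeros of [c], [{f = 0}] and [{g = 0}] form a clopen partition. *)
Lemma product_zero_on_ball (n : nat) (c : mpoly.mpoly n C) (f g : 'rV[C]_n -> C)
    (t0 s t : 'rV[C]_n) (rho : C) :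
  (forall x, ball t0 rho x -> mpoly.meval (fun a => x ord0 a) c != 0 ->
     [/\ {for x, continuous f}, {for x, continuous g}, f x * g x = 0 &
         ~ (f x = 0 /\ g x = 0)]) ->
  ball t0 rho s -> ball t0 rho t ->
  mpoly.meval (fun a => s ord0 a) c != 0 -> mpoly.meval (fun a => t ord0 a) c != 0 ->
  f s = 0 -> f t = 0.
Proof.
move=> fg bs bt cs ct fs.
have [gamma [cgamma g0 g1 gP]] := avoiding_path bs bt cs ct.
(* Interiors make [P] and [Q] open outright: continuity of [f] and [g] is known only along the path,
   for [u] in the unit interval. *)
pose P := interior [set u : R | g (gamma u) != 0].
pose Q := interior [set u : R | f (gamma u) != 0].
have inP u : 0 <= u <= 1 -> f (gamma u) = 0 -> P u.
  move=> /gP[bu cu] fu; have [_ gu _ fgN] := fg _ bu cu.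
  apply: (continuous_neq0 (f := g \o gamma)).
    exact: continuous_comp (cgamma u) gu.
  by apply/eqP => gu0; exact: fgN.
have inQ u : 0 <= u <= 1 -> f (gamma u) != 0 -> Q u.
  move=> /gP[bu cu] fu; have [fcu _ _ _] := fg _ bu cu.
  apply: (continuous_neq0 (f := f \o gamma)) => //.
  exact: continuous_comp (cgamma u) fcu.
have I0 : 0 <= (0 : R) <= 1 by rewrite lexx ler01.
have I1 : 0 <= (1 : R) <= 1 by rewrite lexx ler01.
case: (connected_split (@segment_connected R 0 1) (@open_interior _ _ : open P)
  (@open_interior _ _ : open Q)).
- move=> u; rewrite /= in_itv /= => u01.
  by have [/(inP _ u01)|/(inQ _ u01)] := eqVneq (f (gamma u)) 0; [left|right].
- apply/seteqP; split=> // u [[]]; rewrite /= in_itv /= => /gP[bu cu].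
  move=> /interior_subset/= gu /interior_subset/= fu.
  by have [_ _ /eqP] := fg _ bu cu; rewrite mulf_eq0 (negPf gu) (negPf fu).
- move=> /(_ 1); rewrite /= in_itv /= => /(_ I1) /interior_subset /= gt.
  have [_ _ /eqP + _] := fg _ bt ct.
  by rewrite -g1 mulf_eq0 (negPf gt) orbF => /eqP.
move=> /(_ 0); rewrite /= in_itv /= => /(_ I0) /interior_subset /=.
by rewrite g0 fs eqxx.
Qed.

Lemma vanish_by_density (n : nat) (c : mpoly.mpoly n C) (f : 'rV[C]_n -> C)
    (v x : 'rV[C]_n) (V : set 'rV[C]_n) :
  mpoly.meval (fun a => v ord0 a) c != 0 -> nbhs x V -> {for x, continuous f} ->
  (forall y, V y -> mpoly.meval (fun a => y ord0 a) c != 0 -> f y = 0) -> f x = 0.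
Proof.
move=> cv Vx fx fV; apply/eqP; apply/negPn/negP => fx0.
have := nonzero_near cv (filterI Vx (continuous_neq0 fx fx0)).
move=> [y [Vy /= /eqP fy] cy].
by apply: fy; exact: fV.
Qed.

(** On a small ball, avoiding paths show that one of [f], [g] vanishes off the zeros of [c0 * c],
    and density extends this to the points of [X] in the ball. Thus [Z f] and [Z g] cover [U], and
    connectedness of [U] selects one of them. *)
Lemma connected_dichotomy (n : nat) (U : set 'rV[C]_n) (c0 c : mpoly.mpoly n C) :
  open U -> connected U ->
  let X := [set x | U x /\ mpoly.meval (fun a => x ord0 a) c0 != 0] in
  dichotomy X [set f : 'rV[C]_n -> C | forall x, X x -> {for x, continuous f}]
    (fun x => mpoly.meval (fun a => x ord0 a) c).
Proof.
move=> oU cU X f g /= fc gc [v [Uv c0v] cv] fg0 fgc.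
pose d := c0 * c.
have dE (x : 'rV[C]_n) : mpoly.meval (fun a => x ord0 a) d
    = mpoly.meval (fun a => x ord0 a) c0 * mpoly.meval (fun a => x ord0 a) c
  by rewrite mpoly.mevalM.
have dv : mpoly.meval (fun a => v ord0 a) d != 0 by rewrite dE mulf_neq0.
have dX (x : 'rV[C]_n) : U x -> mpoly.meval (fun a => x ord0 a) d != 0 -> X x.
  by move=> Ux; rewrite dE mulf_eq0 negb_or => /andP[].
(* The condition is void off [X], so these sets can cover [U] and not merely [X]. *)
pose Z (h : 'rV[C]_n -> C) : set 'rV[C]_n := interior [set x | X x -> h x = 0].
have sub (h : 'rV[C]_n -> C) (x : 'rV[C]_n) : (forall x, X x -> {for x, continuous h}) ->
    (exists2 V, nbhs x V & forall y, V y ->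
       U y /\ (mpoly.meval (fun a => y ord0 a) d != 0 -> h y = 0)) ->
    Z h x.
  move=> hc [V /nbhs_interior Vx VP]; apply: filterS Vx => y Vy Xy.
  by apply: (vanish_by_density dv Vy (hc _ Xy)) => z /VP[].
case: (connected_split cU (@open_interior _ _ : open (Z f)) (@open_interior _ _ : open (Z g))).
- move=> x Ux; have : nbhs x U by exact: open_nbhs_nbhs.
  move=> /nbhs_ballP[rho rho0 bU].
  have bx : nbhs x (ball x rho) by exact: nbhsx_ballx.
  have [s bs ds] := nonzero_near dv bx.
  have fgb y : ball x rho y -> mpoly.meval (fun a => y ord0 a) d != 0 ->
      [/\ {for y, continuous f}, {for y, continuous g}, f y * g y = 0 & ~ (f y = 0 /\ g y = 0)].
    move=> by_ dy; have Xy := dX _ (bU _ by_) dy.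
    split; [exact: fc|exact: gc|exact: fg0|case=> fy gy].
    by move: dy; rewrite dE (fgc y) // mulr0 eqxx.
  have Xs := dX _ (bU _ bs) ds.
  have /eqP := fg0 s Xs; rewrite mulf_eq0 => /orP[/eqP fs|/eqP gs]; [left|right].
    apply: (sub f x fc); exists (ball x rho); first exact: bx.
    move=> y by_; split; first exact: bU.
    by move=> dy; exact: (product_zero_on_ball fgb bs by_ ds dy fs).
  have gfb y : ball x rho y -> mpoly.meval (fun a => y ord0 a) d != 0 ->
      [/\ {for y, continuous g}, {for y, continuous f}, g y * f y = 0 & ~ (g y = 0 /\ f y = 0)].
    move=> by_ dy; have [fy gy fgy fgNy] := fgb y by_ dy.
    by split; [exact: gy|exact: fy|rewrite mulrC|case=> ? ?; exact: fgNy].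
  apply: (sub g x gc); exists (ball x rho); first exact: bx.
  move=> y by_; split; first exact: bU.
  by move=> dy; exact: (product_zero_on_ball gfb bs by_ ds dy gs).
- apply/seteqP; split=> // x [[Ux fx] gx].
  (* Near a point of both sets there is a [y] with [d] nonzero where [f] and [g] both vanish, which
     forces [c] to vanish at [y]. *)
  have [|y [fy [gy Uy]] dy] := @nonzero_near _ d x v
      [set y | (X y -> f y = 0) /\ (X y -> g y = 0) /\ U y] dv.
    apply: filterI; first exact: fx.
    by apply: filterI; [exact: gx|exact: open_nbhs_nbhs].
  have Xy := dX _ Uy dy.
  by move: dy; rewrite dE (fgc y) ?mulr0 ?eqxx //; [exact: fy|exact: gy].
- by move=> UZ; left=> x Xx; have /interior_subset := UZ _ Xx.1; exact.
- by move=> UZ; right=> x Xx; have /interior_subset := UZ _ Xx.1; exact.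
Qed.
End Topology.

(** * Zariski closures and irreducibility *)

Section Zariski.
Local Set Implicit Arguments.
Local Unset Strict Implicit.
Variables (R : realType) (N : nat).
Local Notation C := (Cplx R).
Implicit Types (A B W : set ('I_N -> C)) (p q : mpoly.mpoly N C).

(** For nonempty [W], primality of [vanishing_ideal W]. *)
Definition prime_on (W : set ('I_N -> C)) : Prop :=
  forall p q, (forall v, W v -> mpoly.meval v p * mpoly.meval v q = 0) ->
  (forall v, W v -> mpoly.meval v p = 0) \/ (forall v, W v -> mpoly.meval v q = 0).

Lemma sub_zariski_closure A : A `<=` zariski_closure A.
Proof. by move=> v Av p; exact. Qed.

Lemma zariski_closure_min A B :
  A `<=` zariski_closure B -> zariski_closure A `<=` zariski_closure B.
Proof. by move=> AB v Av p Bp; apply: Av => w /AB; exact. Qed.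

Lemma irreducible_prime_on W : irreducible_set W -> prime_on W.
Proof.
move=> [[S WS] _ Wirr] p q pq0.
have algI p' : algebraic_set (W `&` zero_set [set p']).
  exists (S `|` [set p']); rewrite WS; apply/seteqP; split=> v.
    by move=> [Sv pv] s [/Sv|/pv].
  by move=> Spv; split=> s Ss; apply: Spv; [left|right].
have zp p' : W = W `&` zero_set [set p'] -> forall v, W v -> mpoly.meval v p' = 0.
  by move=> -> v [_]; exact.
have [||] := Wirr _ _ (algI p) (algI q); last 2 first.
- by move=> /zp; left.
- by move=> /zp; right.
apply/seteqP; split=> v; last by case=> -[].
move=> Wv; have /eqP := pq0 v Wv; rewrite mulf_eq0.
by case/orP => /eqP v0; [left|right]; split => // _ ->.
Qed.

(** If neither closed piece contains [A], each has an equation not vanishing identically on [A]; the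
    product of the two vanishes on [A], against primality. *)
Lemma irreducible_zariski_closure A :
  A !=set0 -> prime_on A -> irreducible_set (zariski_closure A).
Proof.
move=> [a Aa] pA; split; first by exists (vanishing_ideal A).
  by move=> A0; have := sub_zariski_closure Aa; rewrite A0.
move=> B1 B2 [S1 ->] [S2 ->] AE.
have closed_sub S : A `<=` zero_set S -> zariski_closure A `<=` zero_set S.
  by move=> AS v Av p Sp; apply: Av => w /AS; exact.
have [A1|A1] := pselect (A `<=` zero_set S1).
  by left; apply/seteqP; split; [exact: closed_sub|rewrite AE; exact: subsetUl].
have [A2|A2] := pselect (A `<=` zero_set S2).
  by right; apply/seteqP; split; [exact: closed_sub|rewrite AE; exact: subsetUr].
exfalso; move: A1 A2 => /existsNP[v1 /not_implyP[Av1 /existsNP[p1 /not_implyP[Sp1 p1v]]]].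
move=> /existsNP[v2 /not_implyP[Av2 /existsNP[p2 /not_implyP[Sp2 p2v]]]].
have [v Av||] := pA p1 p2; last 2 first.
- by move=> /(_ _ Av1).
- by move=> /(_ _ Av2).
have := sub_zariski_closure Av; rewrite AE => -[/(_ _ Sp1) ->|/(_ _ Sp2) ->].
  by rewrite mul0r.
by rewrite mulr0.
Qed.

End Zariski.

Lemma meval_monomial_sub (A : comNzRingType) (N : nat) (v : 'I_N -> A) k d
    (p q : mpoly.mpoly N A) :
  mpoly.meval v (mpoly.mpolyX A (mpoly.mnm1 k) ^+ d * p - q)
  = v k ^+ d * mpoly.meval v p - mpoly.meval v q.
Proof. by rewrite rmorphB rmorphM rmorphXn /= mpoly.mevalXU. Qed.

(** * The incidence variety inside the auxiliary variety *)

Section RadicalParametrization.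
Local Set Implicit Arguments.
Local Unset Strict Implicit.
Variables (R : realType) (n m r : nat) (e : 'I_m -> nat).
Local Notation C := (Cplx R).
Variables (aN aD : 'I_m -> mpoly.mpoly (n + m) C) (xN xD : 'I_r -> mpoly.mpoly (n + m) C).
Variables (U : set 'rV[C]_n) (delta : 'I_m -> 'rV[C]_n -> C) (L : mpoly.mpoly (n + m) C).
Hypothesis e_gt0 : forall i, (0 < e i)%N.
Hypothesis openU : open U.
Hypothesis connectedU : connected U.
Hypothesis delta_cont : forall i t, U t -> {for t, continuous (delta i)}.
Hypothesis aN_vars : forall i : 'I_m, only_vars (fun k : 'I_(n + m) => (k < n + i)%N) (aN i).
Hypothesis aD_vars : forall i : 'I_m, only_vars (fun k : 'I_(n + m) => (k < n + i)%N) (aD i).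
Hypothesis deltaE : forall i t, U t ->
  delta i t ^+ e i * mpoly.meval (td_of delta t) (aD i) = mpoly.meval (td_of delta t) (aN i).
Hypothesis domain_neq0 : phi_domain U delta aD xD !=set0.
Hypothesis L_lcm : is_lcm (denominators aD xD) L.

Let dom := phi_domain U delta aD xD.
Let phi := phi_map delta xN xD.

Lemma td_of_lshift (t : 'rV[C]_n) a : td_of delta t (lshift m a) = t ord0 a.
Proof. by rewrite /td_of /td_point (unsplitK (inl a)). Qed.

Lemma td_of_rshift (t : 'rV[C]_n) i : td_of delta t (rshift n i) = delta i t.
Proof. by rewrite /td_of /td_point (unsplitK (inr i)). Qed.

Lemma phi_lshift (t : 'rV[C]_n) k : phi t (lshift r k) = td_of delta t k.
Proof. by rewrite /phi /phi_map (unsplitK (inl k)). Qed.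

Lemma phi_rshift (t : 'rV[C]_n) j : phi t (rshift (n + m) j) = x_of delta xN xD j t.
Proof. by rewrite /phi /phi_map (unsplitK (inr j)). Qed.

Lemma meval_phi_lshift (t : 'rV[C]_n) p :
  mpoly.meval (fun k => phi t (lshift r k)) p = mpoly.meval (td_of delta t) p.
Proof. by apply: mpoly.meval_eq => k; exact: phi_lshift. Qed.

Lemma continuous_td_of (t : 'rV[C]_n) k : U t -> {for t, continuous (fun s => td_of delta s k)}.
Proof.
move=> Ut; case: (split_ordP k) => [a|i] ->.
  under [X in {for _, continuous X}]eq_fun do rewrite td_of_lshift.
  exact: coord_continuous.
under [X in {for _, continuous X}]eq_fun do rewrite td_of_rshift.
exact: delta_cont.
Qed.

Lemma continuous_phi (t : 'rV[C]_n) k : dom t -> {for t, continuous (fun s => phi s k)}.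
Proof.
move=> [Ut _ xt]; case: (split_ordP k) => [a|j] ->.
  under [X in {for _, continuous X}]eq_fun do rewrite phi_lshift.
  exact: continuous_td_of.
under [X in {for _, continuous X}]eq_fun do rewrite phi_rshift.
have cN : {for t, continuous (fun s => mpoly.meval (td_of delta s) (xN j))}.
  by apply: continuous_meval => l; exact: continuous_td_of.
have cD : {for t, continuous (fun s => mpoly.meval (td_of delta s) (xD j))}.
  by apply: continuous_meval => l; exact: continuous_td_of.
exact: continuousM cN (continuousV (xt j) cD).
Qed.

Definition nonvanishing (c : mpoly.mpoly n C) : set 'rV[C]_n :=
  [set t | U t /\ mpoly.meval (fun a => t ord0 a) c != 0].

Lemma nbhs_nonvanishing c t : nonvanishing c t -> nbhs t (nonvanishing c).
Proof.
move=> [Ut ct]; have := continuous_neq0 (@continuous_poly_row R n c t) ct.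
by apply: filterS2 (open_nbhs_nbhs (conj openU Ut)) => x Ux cx; split.
Qed.

Definition denominators_prod : mpoly.mpoly (n + m) C := \prod_i aD i * \prod_j xD j.

Lemma denominators_prod_neq0 t : U t ->
  mpoly.meval (td_of delta t) denominators_prod != 0 <-> dom t.
Proof.
move=> Ut; rewrite mpoly.mevalM !rmorph_prod /= mulf_eq0 negb_or; split.
  move=> /andP[/prodf_neq0 a0 /prodf_neq0 x0].
  by split => // [i|j]; [exact: a0|exact: x0].
by move=> [_ a0 x0]; apply/andP; split; apply/prodf_neq0 => k _.
Qed.

Lemma continuous_good (X : set 'rV[C]_n)
    (good := [set f : 'rV[C]_n -> C | forall x, X x -> {for x, continuous f}]) :
  [/\ forall z, good (fun=> z),
      forall f g, good f -> good g -> good (fun x => f x + g x)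
    & forall f g, good f -> good g -> good (fun x => f x * g x)].
Proof.
split.
- by move=> z x _; exact: cst_continuous.
- by move=> f g gf gg x Xx; exact: continuousD (gf x Xx) (gg x Xx).
- by move=> f g gf gg x Xx; exact: continuousM (gf x Xx) (gg x Xx).
Qed.

(** The product of all denominators lies in the tower of the [delta i], so it divides a nonzero
    polynomial in [T]. This places the complement of a hypersurface inside the domain, where the
    dichotomy is available. *)
Lemma sub_domain : exists c, nonvanishing c !=set0 /\ nonvanishing c `<=` dom.
Proof.
have [t1 dt1] := domain_neq0; have [Ut1 a1 _] := dt1.
(* With the constant 1 this is all of [U]. *)
pose X := nonvanishing 1.
have X1 t : U t -> X t by move=> Ut; split; rewrite // mpoly.meval1 oner_neq0.
have [gc ga gm] := continuous_good X.
have [|a||k|k nk||] := @radical_tower R _ X _ n (n + m) (n + m) (fun t a => t ord0 a)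
  (td_of delta) id gc ga gm _ _ _ _ _ denominators_prod.
- by move=> k x [Ux _]; exact: continuous_td_of.
- by exists (lshift m a) => x; rewrite td_of_lshift.
- by move=> c; exact: connected_dichotomy.
- case: (split_ordP k) => [a|i] -> /=; first by move=> _; exists a => x; exact: td_of_lshift.
  by move=> na; exfalso; move: na; rewrite ?ltnNge ?leq_addr.
- case: (split_ordP k) nk => [a|i] -> /=;
    first by move=> na; exfalso; move: na; rewrite leqNgt ltn_ord.
  move=> _; exists (e i), (aN i), (aD i); split => //; first by exists t1; [exact: X1|exact: a1].
  by move=> x [Ux _]; rewrite td_of_rshift deltaE.
- move=> /(_ _ (X1 _ Ut1))/eqP; have /denominators_prod_neq0 := Ut1.
  by move=> /iffRL/(_ dt1) /negPf ->.
move=> [q [c [[x [Ux _] cx] qE]]]; exists c; split; first by exists x.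
move=> t [Ut ct]; apply/denominators_prod_neq0 => //.
by apply: contraNneq ct => p0; rewrite -qE ?p0 ?mul0r //; exact: X1.
Qed.

(** If [f] is not identically zero along [phi], it divides a nonzero [c] in [T], so [g] vanishes off
    the zeros of [c0 * c], and then on all of [dom] by continuity. *)
Lemma prime_on_image : prime_on (phi @` dom).
Proof.
have [c0 [[x0 Xx0] Xdom]] := sub_domain.
pose X := nonvanishing c0.
have [gc ga gm] := continuous_good X.
move=> f g fg0.
have dense c h (v : 'rV[C]_n) : mpoly.meval (fun a => v ord0 a) c != 0 ->
    (forall x, U x -> mpoly.meval (fun a => x ord0 a) c != 0 -> mpoly.meval (phi x) h = 0) ->
    forall w, (phi @` dom) w -> mpoly.meval w h = 0.
  move=> cv hc _ [t dt <-]; have [Ut _ _] := dt.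
  apply: (vanish_by_density cv (open_nbhs_nbhs (conj openU Ut)) _ hc).
  by apply: continuous_meval => k; exact: continuous_phi.
have [|a||k|k nk||] := @radical_tower R _ X _ n (n + m + r) (n + m) (fun t a => t ord0 a)
  phi (lshift r) gc ga gm _ _ _ _ _ f.
- by move=> k x /Xdom; exact: continuous_phi.
- by exists (lshift r (lshift m a)) => x; rewrite phi_lshift td_of_lshift.
- by move=> c; exact: connected_dichotomy.
- case: (split_ordP k) => [k'|j] -> /=;
    last by move=> na; exfalso; move: na; rewrite ?ltnNge -?addnA ?leq_addr.
  case: (split_ordP k') => [a|i] -> /=;
    last by move=> na; exfalso; move: na; rewrite ?ltnNge ?leq_addr.
  by move=> _; exists a => x; rewrite phi_lshift td_of_lshift.
- have [_ a0 xD0] := Xdom _ Xx0.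
  case: (split_ordP k) nk => [k'|j] -> /= nk.
    case: (split_ordP k') nk => [a|i] -> /=;
    first by move=> na; exfalso; move: na; rewrite leqNgt ltn_ord.
    move=> _; exists (e i), (aN i), (aD i); split => //.
      by exists x0 => //; rewrite meval_phi_lshift.
    by move=> x [Ux _]; rewrite !meval_phi_lshift phi_lshift td_of_rshift deltaE.
  (* The coordinate [x_j] is adjoined as a radical of exponent 1. *)
  exists 1%N, (xN j), (xD j); split => //.
  + by move=> mono l _ /=; rewrite (leq_trans (ltn_ord l)) ?leq_addr.
  + by move=> mono l _ /=; rewrite (leq_trans (ltn_ord l)) ?leq_addr.
  + by exists x0 => //; rewrite meval_phi_lshift.
  + move=> x /Xdom[_ _ xx]; rewrite !meval_phi_lshift phi_rshift expr1.
    by rewrite /x_of divfK.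
- by move=> f0; left; apply: (dense c0 f x0 Xx0.2) => x Ux cx; exact: (f0 x (conj Ux cx)).
move=> [q [c [[v [Uv c0v] cv] qE]]]; right; apply: (dense (c0 * c) g v).
  by rewrite mpoly.mevalM mulf_neq0.
move=> x Ux; rewrite mpoly.mevalM mulf_eq0 negb_or => /andP[c0x cx].
have Xx : X x := conj Ux c0x.
have /eqP := fg0 (phi x) (ex_intro2 _ _ x (Xdom _ Xx) erefl).
rewrite mulf_eq0 => /orP[/eqP fx|/eqP//].
by move: cx; rewrite -qE // fx mul0r eqxx.
Qed.

Lemma image_sub_aux : phi @` dom `<=` aux_projection e aN aD xN xD L.
Proof.
move=> _ [t dt <-]; have [Ut a0 x0] := dt.
exists (mpoly.meval (td_of delta t) L)^-1 => /=; split.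
- by move=> i; rewrite !meval_phi_lshift phi_lshift td_of_rshift deltaE // subrr.
- by move=> j; rewrite !meval_phi_lshift phi_rshift /x_of divfK // subrr.
rewrite meval_phi_lshift mulVf ?subrr //.
(* The product of the denominators is a common multiple, so [L] divides it and cannot vanish on
   [dom]; hence [z] may be the inverse of [L]. *)
have [_ /(_ denominators_prod)[|s sE]] := L_lcm.
  move=> p [[j ->]|[i ->]].
    exists (\prod_i aD i * \prod_(k | k != j) xD k).
    by rewrite /denominators_prod (bigD1 (P := xpredT) j) //= mulrCA.
  exists (\prod_(k | k != i) aD k * \prod_j xD j).
  by rewrite /denominators_prod (bigD1 (P := xpredT) i) //= mulrA.
have /denominators_prod_neq0 := Ut; move=> /iffRL/(_ dt).
by rewrite sE mpoly.mevalM mulf_eq0 negb_or => /andP[].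
Qed.

Definition lift_poly (p : mpoly.mpoly (n + m) C) : mpoly.mpoly (n + m + r) C :=
  mpoly.comp_mpoly [tuple mpoly.mpolyX _ (mpoly.mnm1 (lshift r k)) | k < n + m] p.

Lemma meval_lift_poly v p : mpoly.meval v (lift_poly p) = mpoly.meval (fun k => v (lshift r k)) p.
Proof.
rewrite mpoly.comp_mpoly_meval; apply: mpoly.meval_eq => k.
by rewrite tnth_mktuple mpoly.mevalXU.
Qed.

(** Common form of the equations [E_i], with [d = e i], and [G_j], with [d = 1]. *)
Definition radical_poly (k : 'I_(n + m + r)) d (pD pN : mpoly.mpoly (n + m) C) :=
  mpoly.mpolyX C (mpoly.mnm1 k) ^+ d * lift_poly pD - lift_poly pN.

Lemma meval_radical_poly v k d pD pN : mpoly.meval v (radical_poly k d pD pN)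
  = v k ^+ d * mpoly.meval (fun l => v (lshift r l)) pD - mpoly.meval (fun l => v (lshift r l)) pN.
Proof.
rewrite /radical_poly meval_monomial_sub; congr (_ * _ - _); exact: meval_lift_poly.
Qed.

(* [W] is algebraic over the coordinates [T]: a polynomial [f] vanishing on the
   image but not on [W] would divide, on [W], a nonzero polynomial in [T],
   which would then vanish on an open set. *)
Lemma irreducible_between W : irreducible_set W ->
  zariski_closure (phi @` dom) `<=` W -> W `<=` auxiliary_variety e aN aD xN xD L ->
  W = zariski_closure (phi @` dom).
Proof.
move=> /irreducible_prime_on Wprime BW WA; apply/seteqP; split => // w Ww f f0.
have imW t : dom t -> W (phi t).
  by move=> dt; apply/BW/sub_zariski_closure; exists t.
have [t1 dt1] := domain_neq0; have [Ut1 a0 x0] := dt1.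
pose good : set (('I_(n + m + r) -> C) -> C) := [set F | exists p, forall v, F v = mpoly.meval v p].
have gc z : good (fun=> z) by exists (mpoly.mpolyC _ z) => v; rewrite mpoly.mevalC.
have ga F G : good F -> good G -> good (fun v => F v + G v).
  by move=> [p pE] [q qE]; exists (p + q) => v; rewrite mpoly.mevalD pE qE.
have gm F G : good F -> good G -> good (fun v => F v * G v).
  by move=> [p pE] [q qE]; exists (p * q) => v; rewrite mpoly.mevalM pE qE.
(* Equations of the projection persist on its closure, hence on [W]. *)
have auxW p v : (forall u, aux_projection e aN aD xN xD L u -> mpoly.meval u p = 0) -> W v ->
    mpoly.meval v p = 0.
  by move=> pA /WA; exact.
have [|a||k|k nk||] := @radical_tower R _ W good n (n + m + r) (n + m)
  (fun v a => v (lshift r (lshift m a))) id (lshift r) gc ga gm _ _ _ _ _ f.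
- by move=> k; exists (mpoly.mpolyX _ (mpoly.mnm1 k)) => v; rewrite mpoly.mevalXU.
- by exists (lshift r (lshift m a)).
(* For polynomial functions on [W] the dichotomy is primality. *)
- move=> c F G [p pE] [q qE] _ FG0 _.
  have [v Wv|p0|q0] := Wprime p q; first by rewrite -pE -qE FG0.
    by left=> v Wv; rewrite pE p0.
  by right=> v Wv; rewrite qE q0.
- case: (split_ordP k) => [k'|j] -> /=;
    last by move=> na; exfalso; move: na; rewrite ?ltnNge -?addnA ?leq_addr.
  case: (split_ordP k') => [a|i] -> /=;
    last by move=> na; exfalso; move: na; rewrite ?ltnNge ?leq_addr.
  by move=> _; exists a.
- case: (split_ordP k) nk => [k'|j] -> /= nk.
    case: (split_ordP k') nk => [a|i] -> /=;
    first by move=> na; exfalso; move: na; rewrite leqNgt ltn_ord.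
    move=> _; exists (e i), (aN i), (aD i); split => //.
      by exists (phi t1); [exact: imW|rewrite meval_phi_lshift].
    move=> v Wv; apply/eqP; rewrite -subr_eq0 -meval_radical_poly; apply/eqP.
    apply: auxW Wv => u [z [uE _ _]].
    by rewrite meval_radical_poly uE.
  exists 1%N, (xN j), (xD j); split => //.
  + by move=> mono l _ /=; rewrite (leq_trans (ltn_ord l)) ?leq_addr.
  + by move=> mono l _ /=; rewrite (leq_trans (ltn_ord l)) ?leq_addr.
  + by exists (phi t1); [exact: imW|rewrite meval_phi_lshift].
  + move=> v Wv; apply/eqP; rewrite -subr_eq0 -meval_radical_poly; apply/eqP.
    apply: auxW Wv => u [z [_ uE _]].
    by rewrite meval_radical_poly expr1 uE.
- exact.
move=> [q [c [[v0 _ cv0] qE]]]; exfalso.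
have [c0 [[x Xx] Xdom]] := sub_domain.
(* The point [v0] of [W] may lie off the image; its [T]-coordinates only show that [c] is a nonzero
   polynomial, so [c] is nonzero at some [t] of the domain, where [f] vanishes at [phi t]. *)
have [||t Xt] := @nonzero_near R n c x (\row_a v0 (lshift r (lshift m a))) (nonvanishing c0).
- by under mpoly.meval_eq do rewrite mxE.
- exact: nbhs_nonvanishing.
have dt := Xdom _ Xt.
have := qE _ (imW _ dt); rewrite f0; last by exists t.
rewrite mul0r (@mpoly.meval_eq _ _ _ (fun a => t ord0 a)) => [<-|a]; first by rewrite eqxx.
by rewrite phi_lshift td_of_lshift.
Qed.

End RadicalParametrization.

Theorem theorem3p10 (R : realType) (n m r : nat) (e : 'I_m -> nat)
    (aN aD : 'I_m -> mpoly.mpoly (n + m) (Cplx R))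
    (xN xD : 'I_r -> mpoly.mpoly (n + m) (Cplx R))
    (U : set 'rV[(Cplx R)]_n) (t0 : 'rV[(Cplx R)]_n)
    (delta : 'I_m -> 'rV[(Cplx R)]_n -> (Cplx R))
    (L : mpoly.mpoly (n + m) (Cplx R)) :
  (n < r)%N ->
  (forall i, 0 < e i)%N ->
  (* the branches delta_i are holomorphic on a connected open neighbourhood of t0 *)
  open U -> connected U -> U t0 ->
  (forall (i : 'I_m) (t : 'rV[(Cplx R)]_n), U t -> differentiable (delta i) t) ->
  (* alpha_iN, alpha_iD only involve T, Delta_1, ..., Delta_{i-1} *)
  (forall i : 'I_m, only_vars (fun k : 'I_(n + m) => (k < n + i)%N) (aN i)) ->
  (forall i : 'I_m, only_vars (fun k : 'I_(n + m) => (k < n + i)%N) (aD i)) ->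
  (* denominators are nonzero elements of the tower *)
  (forall i : 'I_m, exists2 t, U t & mpoly.meval (td_of delta t) (aD i) != 0) ->
  (forall j : 'I_r, exists2 t, U t & mpoly.meval (td_of delta t) (xD j) != 0) ->
  (* delta_i^e_i = alpha_i (denominators cleared) *)
  (forall (i : 'I_m) (t : 'rV[(Cplx R)]_n), U t ->
     delta i t ^+ e i * mpoly.meval (td_of delta t) (aD i)
       = mpoly.meval (td_of delta t) (aN i)) ->
  (* the Jacobian of x with respect to t has rank n *)
  (exists2 t, phi_domain U delta aD xD t &
     \rank ('J (fun s : 'rV[(Cplx R)]_n => \row_(j < r) x_of delta xN xD j s) t) = n) ->
  (* L is the lcm of the denominators *)
  is_lcm (denominators aD xD) L ->
  exists! W : set ('I_(n + m + r) -> (Cplx R)),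
    irreducible_component (auxiliary_variety e aN aD xN xD L) W /\
    incidence_variety U delta aD xN xD `<=` W.
Proof.
move=> _ e_gt0 openU connU _ delta_diff aN_vars aD_vars _ _ deltaE [t1 dt1 _] L_lcm.
have delta_cont i t : U t -> {for t, continuous (delta i)}.
  by move=> Ut; apply: differentiable_continuous; exact: delta_diff.
have dom0 : phi_domain U delta aD xD !=set0 by exists t1.
(* This gives both the maximality of the incidence variety and its uniqueness among components
   containing it. *)
have between := irreducible_between e_gt0 openU connU delta_cont aN_vars aD_vars deltaE dom0.
exists (incidence_variety U delta aD xN xD); split; last first.
  by move=> W [[Wirr WA _] BW]; exact: esym (between _ _ _ Wirr BW WA).
split=> //; split.
- apply: irreducible_zariski_closure; first by exists (phi_map delta xN xD t1); exists t1.
  exact: (prime_on_image e_gt0 openU connU delta_cont aN_vars aD_vars deltaE dom0).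
- apply: zariski_closure_min; apply: subset_trans (@sub_zariski_closure _ _ _).
  exact: (image_sub_aux deltaE L_lcm).
- by move=> W Wirr BW WA; exact: (between _ _ _ Wirr BW WA).
Qed.
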